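(* For coefficients $\alpha_1,\alpha_2,\alpha_3,\alpha_4$ with $\alpha_1^2+\alpha_2^2+\alpha_3^2+\alpha_4^2=1$, let $$|\psi\rangle_7=\alpha_1|0000000\rangle+\alpha_2|0001111\rangle+\alpha_3|1111000\rangle+\alpha_4|1110111\rangle$$ and let $R$ be the associated $3^6\times 3$ generalized $R$-matrix. Then $R^\dagger R$ only has diagonal elements: $$(R^\dagger R)_{xx}=(R^\dagger R)_{yy}=16(\alpha_1^2+\alpha_3^2)(\alpha_2^2+\alpha_4^2)+48(\alpha_1^2\alpha_4^2+\alpha_2^2\alpha_3^2),$$ $$(R^\dagger R)_{zz}=1+32\alpha_1^2\alpha_3^2+32\alpha_2^2\alpha_4^2 .$$ A critical point of the upper bound of Bell's inequality, $2\sqrt{u_1^2+u_2^2}$ (where $u_1^2,u_2^2$ are the two largest eigenvalues of $R^\dagger R$), regarded as a function of the normalized coefficients, occurs at $\alpha_1^2=\alpha_2^2=\alpha_3^2=\alpha_4^2=\tfrac14$. This critical point corresponds to $C_{1,A}^2(\psi)=C_{2,A}^2(\psi)=\tfrac34$ and $C_A^2(\psi)=1$, which also corresponds to maximally entangled states. The upper bound of the maximum violation of Bell's inequality there is $4\sqrt5$. The critical point is a saddle point of the upper bound, and hence the quantum states there are not locally maximally entangled (in the sense of the upper bound having a local maximum).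
   Context: The system consists of seven qubits; region $B$ is the first six qubits and region $A$ is the last (seventh) qubit. Set $\rho=|\psi\rangle\langle\psi|$ and $\rho_A=\mathrm{Tr}_B\,\rho$. The coefficients are real. Maximally entangled state: a quantum state which has maximum von Neumann entropy for each bipartition. Generalized $R$-matrix: with $\sigma_x,\sigma_y,\sigma_z$ the Pauli matrices, $R_{i_1i_2\cdots i_7}=\mathrm{Tr}(\rho\,\sigma_{i_1}\otimes\sigma_{i_2}\otimes\cdots\otimes\sigma_{i_7})$ with each $i_k\in\{x,y,z\}$. It is viewed as a $3^6\times 3$ matrix $R_{I i_7}$ with row multi-index $I=i_1\cdots i_6$ and column index $i_7$. The quantity $2\sqrt{u_1^2+u_2^2}$ is an upper bound for the maximum violation $\max_{\mathcal B_7}\mathrm{Tr}(\rho\mathcal B_7)$ of Bell's inequality, where $\mathcal B_7=A_1\otimes\cdots\otimes A_6\otimes(A_7+A_7')+A_1'\otimes\cdots\otimes A_6'\otimes(A_7-A_7')$ with $A_i=\mathbf a_i\cdot\boldsymbol\sigma$, $A_i'=\mathbf a_i'\cdot\boldsymbol\sigma$, $\boldsymbol\sigma=(\sigma_x,\sigma_y,\sigma_z)$ and $\mathbf a_i,\mathbf a_i'$ unit vectors; it is used as a measure of the intensity of quantum entanglement. Concurrences: for a pure state, $C_A(\psi)=\sqrt{2(1-\mathrm{Tr}_A\rho_A^2)}$. Write the coefficients as $\alpha_1=\sin\theta_1$, $\alpha_2=\cos\theta_1\sin\theta_2$, $\alpha_3=\cos\theta_1\cos\theta_2\cos\theta_3$,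 $\alpha_4=\cos\theta_1\cos\theta_2\sin\theta_3$. Then $C_{1,A}(\psi)$ is the concurrence $C_A$ of the state of the same form obtained by replacing $\theta_2$ by $\pi/2$ and $\theta_3$ by $0$, i.e. with coefficients $(\sin\theta_1,\cos\theta_1,0,0)$, and $C_{2,A}(\psi)$ is the concurrence $C_A$ of the state of the same form obtained by replacing $\theta_3$ by $0$, i.e. with coefficients $(\sin\theta_1,\cos\theta_1\sin\theta_2,\cos\theta_1\cos\theta_2,0)$.
   Formalization: ''Maximally entangled'' fails if the entropy maximum is over all states for each bipartition (first two qubits: ln 2 < 2 ln 2). Proved instead: maximum over all states for one qubit against six (A|B included), and over the states of this family for every bipartition. *)

(* Defs.v *)
From HB Require Import structures.
From mathcomp Require Import all_boot all_order all_algebra.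
From mathcomp Require Export complex.
From mathcomp Require Import all_classical all_reals all_analysis.
Set Implicit Arguments.
Unset Strict Implicit.
Unset Printing Implicit Defensive.
Import Order.TTheory GRing.Theory Num.Theory.
Import numFieldNormedType.Exports.
Local Open Scope classical_set_scope.
Local Open Scope ring_scope.
Local Open Scope sesquilinear_scope.

(* Computational basis of n qubits: 'I_2-valued functions on the set of qubits.
   Qubits are numbered from 0, so the last of n.+1 qubits is ord_max. Matrices
   and vectors are indexed by the basis through enum_val. *)
Notation qbasis n := {ffun 'I_n -> 'I_2}.
Notation qdim n := #|{: {ffun 'I_n -> 'I_2}}|.

Section Qubits.
Context {R : realType}.
Local Notation C := R[i].

(* [ket s] is |s_0 s_1 ... s_(n-1)>; the bits are given as 0/1 numerals. *)
Definition ket n (s : seq nat) : 'cV[C]_(qdim n) :=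
  delta_mx (enum_rank [ffun q : 'I_n => inord (nth 0%N s q) : 'I_2]) 0.

Definition normalized m (psi : 'cV[C]_m) : Prop := psi ^t* *m psi = 1%:M.

Definition density m (psi : 'cV[C]_m) : 'M[C]_m := psi *m psi ^t*.

Definition tensor n (A : 'I_n -> 'M[C]_2) : 'M[C]_(qdim n) :=
  \matrix_(i, j) \prod_(q < n) A q ((enum_val i : qbasis n) q) ((enum_val j : qbasis n) q).

(* The indices 0, 1, 2 stand for x, y, z. *)
Definition pauli (k : 'I_3) : 'M[C]_2 :=
  match val k with
  | 0%N => \matrix_(i, j) (if i == j then 0 else 1)
  | 1%N => \matrix_(i, j) (if i == j then 0 else if i == 0 then - 'i else 'i)
  | _ => \matrix_(i, j) (if i == j then (if i == 0 then 1 else -1) else 0)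
  end.

Definition pauli_vec (v : 'rV[R]_3) : 'M[C]_2 :=
  \sum_(k < 3) (v 0 k)%:C%C *: pauli k.

(* Basis of the subsystem formed by the qubits in S. *)
Definition restrict n (S : {set 'I_n}) (x : qbasis n) :
    {ffun {q : 'I_n | q \in S} -> 'I_2} :=
  [ffun q => x (val q)].

(* Partial trace over the qubits outside S: the entry (i, j) sums rho x y over
   the basis strings x, y which extend i, j and agree outside S. *)
Definition reduced n (S : {set 'I_n}) (rho : 'M[C]_(qdim n)) :
    'M[C]_#|{: {ffun {q : 'I_n | q \in S} -> 'I_2}}| :=
  \matrix_(i, j)
    \sum_(x : qbasis n | restrict S x == enum_val i)
      \sum_(y : qbasis n | (restrict S y == enum_val j)
                           && (restrict (~: S) x == restrict (~: S) y))
        rho (enum_rank x) (enum_rank y).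

(* Concurrence between the last qubit (region A) and the others (region B). *)
Definition concurrenceA n (psi : 'cV[C]_(qdim n.+1)) : R :=
  let rhoA := reduced [set ord_max] (density psi) in
  Num.sqrt (2 * (1 - complex.Re (\tr (rhoA *m rhoA)))).

(* Eigenvalues with algebraic multiplicity. *)
Definition eigenvalues m (M : 'M[C]_m) : seq C :=
  sval (closed_field_poly_normal (char_poly M)).

(* ln 0 = 0, hence null eigenvalues contribute 0. *)
Definition vN_entropy m (rho : 'M[C]_m) : R :=
  - \sum_(z <- eigenvalues rho) complex.Re z * ln (complex.Re z).

(* psi has, for the bipartition S | ~: S, the maximum von Neumann entropy
   among the states in P. *)
Definition max_entropy_in n (P : set 'cV[C]_(qdim n))
    (S : {set 'I_n}) (psi : 'cV[C]_(qdim n)) : Prop :=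
  P psi /\
  forall phi, P phi ->
    vN_entropy (reduced S (density phi)) <= vN_entropy (reduced S (density psi)).

(* Rows are indexed by multi-indices over the first n qubits (3 ^ n of them),
   columns by the index of the last qubit. *)
Definition Rmatrix n (psi : 'cV[C]_(qdim n.+1)) :
    'M[C]_(#|{: {ffun 'I_n -> 'I_3}}|, 3) :=
  \matrix_(I, k)
    \tr (density psi *m
         tensor (fun q => pauli (if unlift ord_max q is Some q'
                                 then (enum_val I : {ffun 'I_n -> 'I_3}) q' else k))).

Definition RdagR n (psi : 'cV[C]_(qdim n.+1)) : 'M[C]_3 :=
  (Rmatrix psi) ^t* *m Rmatrix psi.

(* 2 sqrt (u_1^2 + u_2^2), with u_1^2, u_2^2 the two largest eigenvalues of
   R^dagger R (which are real). *)
Definition bell_bound n (psi : 'cV[C]_(qdim n.+1)) : R :=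
  let u2 := sort >=%R (map (@complex.Re R) (eigenvalues (RdagR psi))) in
  2 * Num.sqrt (u2`_0 + u2`_1).

Definition unit_vec (v : 'rV[R]_3) : Prop := \sum_(k < 3) v 0 k ^+ 2 = 1.

Definition bell_op n (a a' : 'I_n.+1 -> 'rV[R]_3) : 'M[C]_(qdim n.+1) :=
  tensor (fun q => if q == ord_max then pauli_vec (a q) + pauli_vec (a' q)
                   else pauli_vec (a q))
  + tensor (fun q => if q == ord_max then pauli_vec (a q) - pauli_vec (a' q)
                     else pauli_vec (a' q)).

Definition psi7 (a : 'rV[R]_4) : 'cV[C]_(qdim 7) :=
    (a 0 0)%:C%C *: ket 7 [:: 0; 0; 0; 0; 0; 0; 0]%N
  + (a 0 1)%:C%C *: ket 7 [:: 0; 0; 0; 1; 1; 1; 1]%N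
  + (a 0 2)%:C%C *: ket 7 [:: 1; 1; 1; 1; 0; 0; 0]%N
  + (a 0 3)%:C%C *: ket 7 [:: 1; 1; 1; 0; 1; 1; 1]%N.

Definition sphere3 : set 'rV[R]_4 := [set a | \sum_(i < 4) a 0 i ^+ 2 = 1].

Definition angle_coef (t1 t2 t3 : R) : 'rV[R]_4 :=
  \row_(i < 4) nth 0 [:: sin t1;
                         cos t1 * sin t2;
                         cos t1 * cos t2 * cos t3;
                         cos t1 * cos t2 * sin t3] i.

Definition C1A (t1 : R) : R := concurrenceA (psi7 (angle_coef t1 (pi / 2) 0)).
Definition C2A (t1 t2 : R) : R := concurrenceA (psi7 (angle_coef t1 t2 0)).

(* For D a submanifold: f has zero derivative at a along every curve in D
   through a; only the values of f on D matter. *)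
Definition critical_on m (D : set 'rV[R]_m) (f : 'rV[R]_m -> R)
    (a : 'rV[R]_m) : Prop :=
  D a /\
  forall c : R -> 'rV[R]_m,
    (\forall t \near (0 : R), D (c t)) -> c 0 = a -> derivable c 0 1 ->
    is_derive (0 : R) (1 : R) (f \o c) 0.

Definition local_max_on m (D : set 'rV[R]_m) (f : 'rV[R]_m -> R)
    (a : 'rV[R]_m) : Prop :=
  D a /\ \forall b \near a, D b -> f b <= f a.

Definition local_min_on m (D : set 'rV[R]_m) (f : 'rV[R]_m -> R)
    (a : 'rV[R]_m) : Prop :=
  D a /\ \forall b \near a, D b -> f a <= f b.

Definition saddle_on m (D : set 'rV[R]_m) (f : 'rV[R]_m -> R)
    (a : 'rV[R]_m) : Prop :=
  [/\ critical_on D f a, ~ local_max_on D f a & ~ local_min_on D f a].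

End Qubits.

(* Main.v *)
Require Import Defs.
From mathcomp Require Import all_boot all_order all_algebra.
From mathcomp Require Import all_classical all_reals all_analysis.
From mathcomp Require Import ring lra.
Import Order.TTheory GRing.Theory Num.Theory.
Import numFieldNormedType.Exports.
Local Open Scope classical_set_scope.
Local Open Scope ring_scope.
Local Open Scope sesquilinear_scope.
Set Implicit Arguments.
Unset Strict Implicit.
Unset Printing Implicit Defensive.

(** Each branch of the state has a definite bit string, so every correlator
    [Tr(rho sigma_I (x) sigma_j)] is a sum over pairs of branches. Summing over [I]
    with the completeness relation
    [sum_k conj(sigma_k x y) sigma_k x' y' = 2 [x=x'][y=y'] - [x=y][x'=y']]
    qubit by qubit leaves an integer weight on pairs of pairs of branches, which is
    nonzero only for two diagonal pairs or for twice the same pair; this gives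
    [R^dagger R]. Writing [p_i = a_i^2], near [p_i = 1/4] the two largest eigenvalues
    both equal [16(p1+p3)(p2+p4) + 48(p1p4+p2p3)], whose gradient there is constant
    in the coordinates [p_i], hence the critical point; the tilts
    [p = (1+t,1-t,1-t,1+t)/4] and [(1+t,1+t,1-t,1-t)/4] change it by [+6t^2] and
    [-6t^2]. For the entropies, one side of any bipartition separates the four
    branches while the other separates them into [r = 2] or [4] equal classes, so
    the entropy is that of the class probabilities, at most [ln r]. *)

Local Notation restrict := Defs.restrict.

(** * Spectrum and von Neumann entropy *)

(** Sylvester's determinant identity: the block matrix [M] is cleared by a triangular factor on the
    right, giving A B, and by another on the left, giving B A. *)
Lemma char_poly_mulmxC (K : comNzRingType) (m n : nat)
    (A : 'M[K]_(m, n)) (B : 'M[K]_(n, m)) :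
  'X^n * char_poly (A *m B) = 'X^m * char_poly (B *m A).
Proof.
pose A' := map_mx (@polyC K) A; pose B' := map_mx (@polyC K) B.
pose M : 'M[{poly K}]_(m + n) := block_mx 'X%:M A' B' 1%:M.
have detM : \det M = char_poly (A *m B).
  have <- : \det (M *m block_mx 1%:M 0 (- B') 1%:M) = char_poly (A *m B).
    rewrite mulmx_block !mulmx1 !mulmx0 mul1mx !add0r mulmxN subrr.
    by rewrite det_ublock det1 mulr1 /char_poly /char_poly_mx map_mxM.
  by rewrite det_mulmx det_lblock !det1 !mulr1.
have : \det (block_mx 1%:M 0 (- B') 'X%:M *m M) = 'X^m * char_poly (B *m A).
  rewrite mulmx_block !mul1mx !mul0mx !mulmx1 !addr0 !mulNmx.
  rewrite -scalar_mxC addNr det_ublock det_scalar.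
  by rewrite /char_poly /char_poly_mx map_mxM addrC.
by rewrite det_mulmx det_lblock det1 mul1r det_scalar detM.
Qed.

Section Spectrum.
Context (R : realType).
Local Notation C := R[i].

Lemma prod_eigenvalues m (M : 'M[C]_m) :
  \prod_(z <- eigenvalues M) ('X - z%:P) = char_poly M.
Proof.
rewrite /eigenvalues; case: closed_field_poly_normal => s /=.
by rewrite (monicP (char_poly_monic M)) scale1r => ->.
Qed.

Lemma eigenvalues_perm m (M : 'M[C]_m) s :
  char_poly M = \prod_(z <- s) ('X - z%:P) -> perm_eq (eigenvalues M) s.
Proof. by move=> Ms; apply: prod_XsubC_eq; rewrite prod_eigenvalues. Qed.

Lemma eigenvalues_diag m (M : 'M[C]_m) : is_diag_mx M ->
  perm_eq (eigenvalues M) [seq M i i | i <- enum 'I_m].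
Proof.
move=> /is_diag_mx_is_trig /char_poly_trig ME; apply: eigenvalues_perm.
by rewrite ME big_map big_enum.
Qed.

Lemma size_eigenvalues m (M : 'M[C]_m) : size (eigenvalues M) = m.
Proof.
by have /eqP := size_char_poly M; rewrite -prod_eigenvalues size_prod_XsubC => /eqP[].
Qed.

Lemma sum_eigenvalues m (M : 'M[C]_m) : \sum_(z <- eigenvalues M) z = \tr M.
Proof.
(* The trace is read off the coefficient of degree m - 1, so m = 0 is treated apart. *)
case: m M => [|m] M.
  by rewrite (size0nil (size_eigenvalues M)) big_nil /mxtrace big_ord0.
apply: oppr_inj; rewrite -char_poly_trace // -coefPn_prod_XsubC.
  by rewrite prod_eigenvalues size_eigenvalues.
by rewrite size_eigenvalues.
Qed.

(** The two spectra differ only by zeros, which contribute nothing. Each side is padded with zeros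
    to a common length before the characteristic polynomials are compared. *)
Lemma vN_entropy_mulmxC m n (A : 'M[C]_(m, n)) (B : 'M[C]_(n, m)) :
  vN_entropy (A *m B) = vN_entropy (B *m A).
Proof.
have E k (s : seq C) : \sum_(z <- nseq k 0 ++ s) complex.Re z * ln (complex.Re z)
    = \sum_(z <- s) complex.Re z * ln (complex.Re z).
  rewrite big_cat /= big1_seq => [|z /andP[_]]; first by rewrite add0r.
  by rewrite mem_nseq => /andP[_ /eqP->]; rewrite mul0r.
have X0 k : \prod_(z <- nseq k 0) ('X - z%:P) = 'X^k :> {poly C}.
  elim: k => [|k IHk] /=; first by rewrite big_nil.
  by rewrite big_cons IHk subr0 exprS.
rewrite /vN_entropy -(E n) -(E m (eigenvalues (B *m A))); congr (- _).
apply/perm_big/prod_XsubC_eq; rewrite !big_cat /= !prod_eigenvalues.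
rewrite !X0; exact: char_poly_mulmxC.
Qed.

Lemma vN_entropy_diag m (M : 'M[C]_m) : is_diag_mx M ->
  vN_entropy M = - \sum_(i < m) complex.Re (M i i) * ln (complex.Re (M i i)).
Proof.
move=> /eigenvalues_diag Md; rewrite /vN_entropy (perm_big _ Md) /=.
by rewrite big_map big_enum.
Qed.

(** The right side is the tangent at 1/n to the concave function -x ln x. Where p < 0 the left side
    is 0 by the convention for [ln], and the tangent is still nonnegative there if its slope ln n -
    1 is at most 0. *)
Lemma entropy_tangent (n : nat) (p : R) : (0 < n)%N ->
  0 <= p \/ ln (n%:R : R) <= 1 -> - (p * ln p) <= p * ln n%:R + n%:R^-1 - p.
Proof.
move=> n0 pn; have n0' : 0 < n%:R :> R by rewrite ltr0n.
have [p0|p0] := leP p 0.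
  rewrite (ln0 p0) mulr0 oppr0; case: pn => pn.
    have -> : p = 0 by apply/eqP; rewrite eq_le p0.
    by rewrite mul0r subr0 add0r invr_ge0 ltW.
  have pL : 0 <= p * (ln n%:R - 1) by rewrite mulr_le0 // subr_le0.
  have n1 : 0 <= n%:R^-1 :> R by rewrite invr_ge0 ltW.
  by rewrite mulrBr mulr1 in pL; lra.
have pn0 : 0 < p * n%:R by rewrite mulr_gt0.
have : ln (1 + ((p * n%:R)^-1 - 1)) <= (p * n%:R)^-1 - 1.
  by apply: le_ln1Dx; rewrite ltrBrDr addrC subrr invr_gt0.
rewrite addrC subrK lnV ?posrE // lnM ?posrE // -(ler_pM2l p0).
have -> : p * ((p * n%:R)^-1 - 1) = n%:R^-1 - p by field; rewrite !gt_eqF.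
by rewrite mulrN mulrDr; lra.
Qed.

(** Summing the tangent bounds, the terms 1/n - p i cancel in total. *)
Lemma entropy_sum_le (n : nat) (I : finType) (p : I -> R) : #|I| = n -> (0 < n)%N ->
  (forall i, 0 <= p i) \/ ln (n%:R : R) <= 1 -> \sum_i p i = 1 ->
  - (\sum_i p i * ln (p i)) <= ln n%:R.
Proof.
move=> cI n0 pn p1; rewrite -sumrN.
have -> : ln n%:R = \sum_i (p i * ln n%:R + n%:R^-1 - p i) :> R.
  rewrite big_split sumrN big_split /= -mulr_suml p1 sumr_const cI.
  by rewrite -[n%:R^-1 *+ n]mulr_natl mulfV ?pnatr_eq0 ?gtn_eqF //; lra.
apply: ler_sum => i _; apply: entropy_tangent => //.
by case: pn => pn; [left|right].
Qed.

Lemma entropy_uniform (n : nat) (I : finType) (p : I -> R) : #|I| = n -> (0 < n)%N ->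
  (forall i, p i = n%:R^-1) -> - (\sum_i p i * ln (p i)) = ln n%:R.
Proof.
move=> cI n0 pE; under eq_bigr do rewrite pE.
rewrite sumr_const cI lnV ?posrE ?ltr0n // mulrN mulNrn opprK -mulrnAl.
by rewrite -[n%:R^-1 *+ n]mulr_natl mulfV ?pnatr_eq0 ?gtn_eqF // mul1r.
Qed.

(** Since ln 2 <= 1, the second alternative of [entropy_sum_le] applies, and the real parts of the
    eigenvalues sum to the trace. *)
Lemma vN_entropy_qubit_le (M : 'M[C]_2) : \tr M = 1 -> vN_entropy M <= ln 2.
Proof.
move=> M1; rewrite /vN_entropy (big_nth 0) size_eigenvalues big_mkord.
apply: (@entropy_sum_le 2) => //; first exact: card_ord.
  right; suff : ln (1 + 1 : R) <= 1 by [].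
  by apply: le_ln1Dx; lra.
rewrite -(raddf_sum (@complex.Re R)).
have := sum_eigenvalues M; rewrite (big_nth 0) size_eigenvalues big_mkord M1.
by move=> ->.
Qed.

End Spectrum.

(** * Superpositions of basis states and their reductions *)

Section Superposition.
Context (R : realType).
Local Notation C := R[i].

Definition superposition n k (s : 'I_k -> qbasis n) (a : 'rV[R]_k) : 'cV[C]_(qdim n) :=
  \sum_m (a 0 m)%:C%C *: delta_mx (enum_rank (s m)) 0.

Lemma superpositionE n k (s : 'I_k -> qbasis n) a x :
  superposition s a (enum_rank x) 0 = \sum_m (a 0 m)%:C%C * (x == s m)%:R.
Proof.
rewrite /superposition summxE; apply: eq_bigr => m _.
by rewrite !mxE eqxx andbT (inj_eq enum_rank_inj).
Qed.

Lemma conj_realC (x : R) : (x%:C%C : C)^* = x%:C%C.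
Proof. by apply/CrealP; rewrite complex_real. Qed.

Lemma density_superpositionE n k (s : 'I_k -> qbasis n) a x y :
  density (superposition s a) (enum_rank x) (enum_rank y)
  = \sum_l \sum_m (a 0 l * a 0 m)%:C%C * ((x == s l) && (y == s m))%:R.
Proof.
rewrite /density mxE big_ord1 !mxE !superpositionE rmorph_sum /= mulr_suml.
apply: eq_bigr => l _; rewrite mulr_sumr; apply: eq_bigr => m _.
by rewrite !rmorphM /= conj_realC conjC_nat -mulnb natrM; ring.
Qed.

Lemma sum_ffun_indicator n (P : pred (qbasis n)) (F : qbasis n -> C) z :
  \sum_(x | P x) F x * (x == z)%:R = F z * (P z)%:R.
Proof.
rewrite big_mkcond (bigD1 z) //= big1 => [|x /negPf ->]; last by rewrite mulr0 if_same.
by rewrite eqxx addr0; case: (P z); rewrite ?mulr1 ?mulr0.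
Qed.

Lemma reduced_superpositionE n k (s : 'I_k -> qbasis n) a (S : {set 'I_n}) i j :
  reduced S (density (superposition s a)) i j
  = \sum_l \sum_m (a 0 l * a 0 m)%:C%C * (restrict (~: S)%SET (s l) == restrict (~: S)%SET (s m))%:R
      * ((restrict S (s l) == enum_val i) && (restrict S (s m) == enum_val j))%:R.
Proof.
rewrite mxE.
under eq_bigr => x _.
  under eq_bigr => y _.
    rewrite density_superpositionE.
    over.
  rewrite exchange_big; under eq_bigr => l _.
    rewrite exchange_big; under eq_bigr => m _.
      under eq_bigr => y _ do rewrite -mulnb natrM mulrA.
      rewrite sum_ffun_indicator.
      over.
    over.
  over.
rewrite exchange_big; apply: eq_bigr => l _.
rewrite exchange_big; apply: eq_bigr => m _ /=.
under eq_bigr => x _ do rewrite mulrAC.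
rewrite (sum_ffun_indicator _ (fun x => _ * (_ && (restrict _ x == _))%:R)).
by rewrite -!mulnb !natrM; ring.
Qed.

Definition class_mx k r (cls : 'I_k -> 'I_r) (a : 'rV[R]_k) : 'M[C]_(k, r) :=
  \matrix_(m, c) ((a 0 m)%:C%C * (cls m == c)%:R).

Lemma sum_indicator (I : finType) (F : I -> C) z : \sum_x F x * (x == z)%:R = F z.
Proof.
rewrite (bigD1 z) //= big1 => [|x /negPf ->]; last by rewrite mulr0.
by rewrite eqxx addr0 mulr1.
Qed.

(** Columns of [class_mx] for distinct classes have disjoint supports, so the Gram matrix is
    diagonal and carries the class probabilities. *)
Lemma vN_entropy_class_mx k r (cls : 'I_k -> 'I_r) (a : 'rV[R]_k) :
  let p c := \sum_(m | cls m == c) a 0 m ^+ 2 in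
  vN_entropy ((class_mx cls a)^T *m class_mx cls a) = - \sum_c p c * ln (p c).
Proof.
move=> p.
have WE c d : ((class_mx cls a)^T *m class_mx cls a) c d = (p c)%:C%C * (c == d)%:R.
  rewrite mxE rmorph_sum /= mulr_suml [RHS]big_mkcond; apply: eq_bigr => m _.
  rewrite !mxE mulrACA -natrM mulnb -rmorphM /=.
  by case: eqP => [->|] //=; rewrite mulr0.
rewrite vN_entropy_diag; last first.
  by apply/is_diag_mxP => i j /negPf ij; rewrite WE -val_eqE ij mulr0.
by congr (- _); apply: eq_bigr => c _; rewrite WE eqxx mulr1.
Qed.

Definition restriction_mx n k (s : 'I_k -> qbasis n) (S : {set 'I_n}) :
    'M[C]_(#|{: {ffun {q : 'I_n | q \in S} -> 'I_2}}|, k) :=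
  \matrix_(i, m) (restrict S (s m) == enum_val i)%:R.

Definition overlap_mx n k (s : 'I_k -> qbasis n) (S : {set 'I_n}) : 'M[C]_k :=
  \matrix_(l, m) (restrict S (s l) == restrict S (s m))%:R.

(** The partial trace keeps the coherence between two branches exactly when they agree outside S,
    hence the overlap matrix of the complement in the middle. *)
Lemma reduced_superposition n k (s : 'I_k -> qbasis n) a (S : {set 'I_n}) :
  let E := restriction_mx s S in
  let D := diag_mx (map_mx (real_complex R) a) in
  reduced S (density (superposition s a)) = E *m (D *m overlap_mx s (~: S)%SET *m D *m E^T).
Proof.
move=> E D.
apply/matrixP => i j; rewrite reduced_superpositionE mxE; apply: eq_bigr => l _.
rewrite mul_mx_diag mul_diag_mx [X in _ = _ * X]mxE mulr_sumr; apply: eq_bigr => m _.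
by rewrite !mxE -mulnb natrM rmorphM /=; ring.
Qed.

Lemma restriction_mx_gram n k (s : 'I_k -> qbasis n) (S : {set 'I_n}) :
  (restriction_mx s S)^T *m restriction_mx s S = overlap_mx s S.
Proof.
have rankE x i : (x == enum_val i) = (i == enum_rank x) :> bool.
  by rewrite eq_sym (can2_eq enum_valK enum_rankK).
apply/matrixP => l m; rewrite !mxE.
under eq_bigr do rewrite !mxE !rankE.
by rewrite sum_indicator (inj_eq enum_rank_inj) eq_sym.
Qed.

(* [reduced S] factors as E G E^T, with E recording the restrictions to S and G
   the overlaps outside S; cycling the factors under [vN_entropy_mulmxC] leaves
   an r x r diagonal matrix. *)
Lemma vN_entropy_superposition n k r (s : 'I_k -> qbasis n) (cls : 'I_k -> 'I_r)
    (a : 'rV[R]_k) (S T : {set 'I_n}) :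
  (S = ~: T \/ T = ~: S)%SET ->
  (forall l m, (restrict T (s l) == restrict T (s m)) = (l == m)) ->
  (forall l m, (restrict S (s l) == restrict S (s m)) = (cls l == cls m)) ->
  let p c := \sum_(m | cls m == c) a 0 m ^+ 2 in
  vN_entropy (reduced S (density (superposition s a))) = - \sum_c p c * ln (p c)
  /\ vN_entropy (reduced T (density (superposition s a))) = - \sum_c p c * ln (p c).
Proof.
move=> ST.
have {ST} [-> TE] : (S = ~: T)%SET /\ (~: (~: T))%SET = T.
  by rewrite finset.setCK; case: ST => -> //; rewrite finset.setCK.
move=> Tinj Scls p.
pose D : 'M[C]_k := diag_mx (map_mx (real_complex R) a).
pose P : 'M[C]_(k, r) := \matrix_(m, c) (cls m == c)%:R.
have KT : overlap_mx s T = 1%:M by apply/matrixP => l m; rewrite !mxE Tinj.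
have KS : overlap_mx s (~: T)%SET = P *m P^T.
  apply/matrixP => l m; rewrite !mxE Scls.
  by under eq_bigr => c _ do rewrite !mxE (eq_sym (cls m)); rewrite sum_indicator.
have WE : class_mx cls a = D *m P.
  by apply/matrixP => l c; rewrite mul_diag_mx !mxE.
have redE U : vN_entropy (reduced U (density (superposition s a)))
    = vN_entropy (D *m overlap_mx s (~: U)%SET *m D *m overlap_mx s U).
  by rewrite reduced_superposition vN_entropy_mulmxC -mulmxA restriction_mx_gram.
(* With W = D P, the side [~: T] gives D D P P^T and the side T gives W W^T; both cycle to W^T W. *)
rewrite !redE TE KT KS -vN_entropy_class_mx WE trmx_mul tr_diag_mx mulmx1; split.
  by rewrite !mulmxA vN_entropy_mulmxC !mulmxA.
by rewrite mulmx1 [RHS]vN_entropy_mulmxC !mulmxA.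
Qed.

(** Two strings agreeing both on S and outside S coincide, so the diagonal of the reduction groups
    the diagonal entries of rho by their restriction to S. *)
Lemma trace_reduced n (S : {set 'I_n}) (rho : 'M[C]_(qdim n)) : \tr (reduced S rho) = \tr rho.
Proof.
have restrict_eq (x y : qbasis n) :
    (restrict S y == restrict S x) && (restrict (~: S)%SET x == restrict (~: S)%SET y) = (y == x).
  apply/andP/eqP => [[/eqP /ffunP yx /eqP /ffunP xy]|->]; last by split.
  apply/ffunP => q; case: (boolP (q \in S)) => qS.
    by have := yx (exist _ q qS); rewrite !ffunE.
  have qS' : q \in (~: S)%SET by rewrite inE.
  by have := xy (exist _ q qS'); rewrite !ffunE.
rewrite /mxtrace (reindex (@enum_rank (qbasis n))) /=; last first.
  by exists enum_val => x _; rewrite ?enum_rankK ?enum_valK.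
rewrite (partition_big (fun x => enum_rank (restrict S x)) predT) //=.
apply: eq_bigr => i _; rewrite mxE.
apply: eq_big => [x|x /eqP <-]; first by rewrite (can2_eq enum_rankK enum_valK).
by rewrite (big_pred1 x).
Qed.

Lemma trace_density m (phi : 'cV[C]_m) : normalized phi -> \tr (density phi) = 1.
Proof. by rewrite /density mxtrace_mulC => ->; rewrite mxtrace1. Qed.

Lemma vN_entropy_reduced1_le n (q : 'I_n) (phi : 'cV[C]_(qdim n)) : normalized phi ->
  vN_entropy (reduced [set q]%SET (density phi)) <= ln 2.
Proof.
move=> /trace_density; rewrite -(trace_reduced [set q]%SET).
have : #|{: {ffun {p : 'I_n | p \in [set q]%SET} -> 'I_2}}| = 2.
  by rewrite card_ffun card_ord card_sig cards1.
(* The dimension is 2 only propositionally, so it is generalized before being substituted. *)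
by move: (reduced _ _); move: #|_| => d M d2; subst d => /vN_entropy_qubit_le.
Qed.

Lemma normalized_superposition n k (s : 'I_k -> qbasis n) (a : 'rV[R]_k) :
  injective s -> \sum_m a 0 m ^+ 2 = 1 -> normalized (superposition s a).
Proof.
move=> s_inj a1; apply/matrixP => i j; rewrite !ord1 mxE [RHS]mxE.
have : \tr (density (superposition s a)) = 1.
  rewrite /mxtrace (reindex (@enum_rank (qbasis n))) /=; last first.
    by exists enum_val => x _; rewrite ?enum_rankK ?enum_valK.
  under eq_bigr do rewrite density_superpositionE.
  rewrite exchange_big -[RHS](rmorph1 (real_complex R)) -a1 rmorph_sum /=.
  apply: eq_bigr => l _; rewrite exchange_big /= (bigD1 l) //= [X in _ + X]big1 => [|m ml].
    under eq_bigr do rewrite andbb.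
    by rewrite sum_indicator addr0 expr2.
  apply: big1 => x _; case: eqP => [->|]; last by rewrite mulr0.
  by rewrite (inj_eq s_inj) eq_sym (negPf ml) mulr0.
by rewrite /density mxtrace_mulC /mxtrace big_ord1 mxE.
Qed.

(** When the traced-out qubits distinguish all branches, no coherence survives and the purity only
    involves the overlaps on S. *)
Lemma trace_sqr_reduced n k (s : 'I_k -> qbasis n) (a : 'rV[R]_k) (S : {set 'I_n}) :
  (forall l m, (restrict (~: S)%SET (s l) == restrict (~: S)%SET (s m)) = (l == m)) ->
  let rho := reduced S (density (superposition s a)) in
  \tr (rho *m rho)
  = (\sum_l \sum_m a 0 l ^+ 2 * a 0 m ^+ 2 * (restrict S (s l) == restrict S (s m))%:R)%:C%C.
Proof.
move=> Sinj rho; rewrite /rho reduced_superposition.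
have -> : overlap_mx s (~: S)%SET = 1%:M by apply/matrixP => l m; rewrite !mxE Sinj.
set E := restriction_mx s S; set D := diag_mx _.
rewrite mulmx1 -mulmxA mxtrace_mulC -!mulmxA restriction_mx_gram (mulmxA E^T).
rewrite restriction_mx_gram !(mulmxA D D) mulmx_diag (mulmxA (diag_mx _)).
rewrite /mxtrace rmorph_sum; apply: eq_bigr => l _; rewrite mxE rmorph_sum.
apply: eq_bigr => m _; rewrite !mul_diag_mx !mxE [restrict S (s m) == _]eq_sym.
by case: eqP => _; rewrite ?mulr0 ?mul0r ?rmorph0 // !mulr1 -!rmorphM /= !expr2.
Qed.

End Superposition.

(** * Correlation matrices *)

Section Correlations.
Context (R : realType).
Local Notation C := R[i].

Lemma trace_density_superposition n k (s : 'I_k -> qbasis n) (a : 'rV[R]_k) T :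
  \tr (density (superposition s a) *m T)
  = \sum_l \sum_m (a 0 l * a 0 m)%:C%C * T (enum_rank (s m)) (enum_rank (s l)).
Proof.
have sum_rank (F : 'I_(qdim n) -> C) : \sum_i F i = \sum_x F (enum_rank x).
  by rewrite (reindex (@enum_rank (qbasis n))) //; exists enum_val => x _;
    rewrite ?enum_rankK ?enum_valK.
rewrite /mxtrace sum_rank; under eq_bigr => x _.
  rewrite mxE sum_rank; under eq_bigr => y _.
    rewrite density_superpositionE mulr_suml; under eq_bigr => l _.
      rewrite mulr_suml; under eq_bigr => m _ do rewrite -mulnb natrM mulrA mulrAC.
      over.
    over.
  rewrite exchange_big; under eq_bigr => l _.
    rewrite exchange_big; under eq_bigr => m _.
      rewrite sum_indicator mulrAC; over.
    over.
  over.
rewrite exchange_big; apply: eq_bigr => l _.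
by rewrite exchange_big; apply: eq_bigr => m _; rewrite sum_indicator.
Qed.

Lemma tensor_recr n (A : 'I_n.+1 -> 'M[C]_2) (x y : qbasis n.+1) :
  tensor A (enum_rank x) (enum_rank y)
  = (\prod_(q < n) A (lift ord_max q) (x (lift ord_max q)) (y (lift ord_max q)))
    * A ord_max (x ord_max) (y ord_max).
Proof.
rewrite mxE !enum_rankK big_ord_recr /=; congr (_ * _); apply: eq_bigr => q _.
have -> // : widen_ord (leqnSn n) q = lift ord_max q.
by apply: val_inj; rewrite /= /bump leqNgt ltn_ord.
Qed.

Lemma Rmatrix_superposition n k (s : 'I_k -> qbasis n.+1) (a : 'rV[R]_k) I j :
  Rmatrix (superposition s a) I j
  = \sum_(p : 'I_k * 'I_k) (a 0 p.1 * a 0 p.2)%:C%C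
      * (\prod_(q < n) pauli ((enum_val I : {ffun 'I_n -> 'I_3}) q)
           (s p.2 (lift ord_max q)) (s p.1 (lift ord_max q)))
      * pauli j (s p.2 ord_max) (s p.1 ord_max).
Proof.
rewrite mxE trace_density_superposition pair_big /=; apply: eq_bigr => -[l m] _ /=.
rewrite tensor_recr unlift_none mulrA; congr (_ * _ * _).
by apply: eq_bigr => q _; rewrite liftK.
Qed.

(** Valued in [int] so that products over the qubits can be evaluated by computation. *)
Definition pauli_overlap (x y x' y' : 'I_2) : int :=
  ((x == x') && (y == y'))%:R *+ 2 - ((x == y) && (x' == y'))%:R.

Lemma pauli_completeness (x y x' y' : 'I_2) :
  \sum_(j < 3) (pauli j x y : C)^* * pauli j x' y' = (pauli_overlap x y x' y')%:~R.
Proof.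
rewrite !big_ord_recl big_ord0 /pauli_overlap !mxE /=.
have ii : 'i * 'i = -1 :> C by rewrite -expr2 sqrCi.
case: x => [[|[|//]] ?]; case: y => [[|[|//]] ?];
case: x' => [[|[|//]] ?]; case: y' => [[|[|//]] ?];
rewrite -!val_eqE /= ?rmorphN /= ?conjCi ?rmorph0 ?rmorph1; ring: ii.
Qed.

(** The sum over row multi-indices of a product over qubits factors into one sum per qubit, each
    evaluated by [pauli_completeness]. *)
Lemma RdagR_superposition n k (s : 'I_k -> qbasis n.+1) (a : 'rV[R]_k) i j :
  RdagR (superposition s a) i j
  = \sum_(p : 'I_k * 'I_k) \sum_(p' : 'I_k * 'I_k)
      (a 0 p.1 * a 0 p.2 * (a 0 p'.1 * a 0 p'.2))%:C%C
      * (\prod_(q < n) pauli_overlap (s p.2 (lift ord_max q)) (s p.1 (lift ord_max q))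
           (s p'.2 (lift ord_max q)) (s p'.1 (lift ord_max q)))%:~R
      * ((pauli i (s p.2 ord_max) (s p.1 ord_max))^* * pauli j (s p'.2 ord_max) (s p'.1 ord_max)).
Proof.
rewrite /RdagR mxE (reindex (@enum_rank {ffun 'I_n -> 'I_3})) /=; last first.
  by exists enum_val => x _; rewrite ?enum_rankK ?enum_valK.
under eq_bigr => I _.
  rewrite [X in X * _]mxE [X in X^* * _]mxE !Rmatrix_superposition rmorph_sum mulr_suml.
  under eq_bigr => p _ do rewrite mulr_sumr.
  over.
rewrite exchange_big; apply: eq_bigr => p _.
rewrite exchange_big; apply: eq_bigr => p' _ /=.
rewrite rmorph_prod /=.
under [X in _ * X * _ ]eq_bigr => q _ do rewrite -pauli_completeness.
rewrite bigA_distr_bigA mulr_sumr mulr_suml; apply: eq_bigr => I _ /=.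
rewrite enum_rankK big_split /= !rmorphM /= rmorph_prod !conj_realC.
ring.
Qed.

End Correlations.

(** * The seven-qubit family *)

Definition branch_bits (m : nat) : seq nat :=
  nth [::] [:: [:: 0; 0; 0; 0; 0; 0; 0]; [:: 0; 0; 0; 1; 1; 1; 1];
               [:: 1; 1; 1; 1; 0; 0; 0]; [:: 1; 1; 1; 0; 1; 1; 1]]%N m.

Definition branch (m : 'I_4) : qbasis 7 :=
  [ffun q : 'I_7 => inord (nth 0%N (branch_bits m) q) : 'I_2].

Lemma val_branch m (q : 'I_7) : branch m q = nth 0%N (branch_bits m) q :> nat.
Proof.
rewrite ffunE inordK //.
by case: m => [[|[|[|[|//]]]] ?]; case: q => [[|[|[|[|[|[|[|//]]]]]]] ?].
Qed.

Lemma sum_ord4 (V : nmodType) (f : 'I_4 -> V) : \sum_m f m = f 0 + f 1 + f 2 + f 3.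
Proof.
rewrite !big_ord_recr big_ord0 /= add0r.
by congr (f _ + f _ + f _ + f _); apply: val_inj.
Qed.

Lemma psi7E (R : realType) (a : 'rV[R]_4) : psi7 a = superposition branch a.
Proof. by rewrite /superposition sum_ord4. Qed.

(** Bits compared as naturals, the form in which [val_branch] can rewrite them. *)
Lemma pauli_overlap_nat (x y x' y' : 'I_2) : pauli_overlap x y x' y'
  = ((x == x' :> nat) && (y == y' :> nat))%:R *+ 2 - ((x == y :> nat) && (x' == y' :> nat))%:R.
Proof. by []. Qed.

(* Branches l and m differ on 3, 4 or 5 of the first six qubits, an odd number
   unless l + m is even; 8, 16 and 32 are the corresponding powers of 2. *)
Definition branch_weight (l m l' m' : nat) : int :=
  if l == m then if l' == m' then if odd (l + l') then -1 else 1 else 0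
  else if (l == l') && (m == m')
       then if (l + m == 3)%N then 32 else if odd (l + m) then 8 else 16
       else 0.

(** For two diagonal pairs a qubit contributes 1 or -1 as the bits agree or not; for twice the same
    pair it contributes 2 where the branches differ and 1 elsewhere. Any other combination meets a
    qubit with factor 0. *)
Lemma branch_weightE (l m l' m' : 'I_4) :
  \prod_(q < 6) pauli_overlap (branch m (lift ord_max q)) (branch l (lift ord_max q))
     (branch m' (lift ord_max q)) (branch l' (lift ord_max q)) = branch_weight l m l' m'.
Proof.
under eq_bigr => q _ do rewrite pauli_overlap_nat !val_branch lift_max.
rewrite !big_ord_recr big_ord0 /=.
by move: l m l' m' => [[|[|[|[|//]]]] ?] [[|[|[|[|//]]]] ?] [[|[|[|[|//]]]] ?] [[|[|[|[|//]]]] ?].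
Qed.

(** Of the 256 terms only 16 + 12 have nonzero weight. *)
Lemma sum_branch_weight (V : pzRingType) (F : 'I_4 -> 'I_4 -> 'I_4 -> 'I_4 -> V) :
  \sum_(p : 'I_4 * 'I_4) \sum_(p' : 'I_4 * 'I_4)
     F p.1 p.2 p'.1 p'.2 * (branch_weight p.1 p.2 p'.1 p'.2)%:~R
  = \sum_l \sum_l' F l l l' l' * (if odd (l + l') then -1 else 1)
    + \sum_l \sum_(m | m != l)
        F l m l m * (if (l + m == 3)%N then 32 else if odd (l + m) then 8 else 16).
Proof.
rewrite -big_split -(pair_big predT predT (fun l m => \sum_(p' : 'I_4 * 'I_4)
     F l m p'.1 p'.2 * (branch_weight l m p'.1 p'.2)%:~R)).
apply: eq_bigr => l _; rewrite (bigD1 l) //=; congr (_ + _).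
  rewrite -(pair_big predT predT (fun l' m' => F l l l' m' * (branch_weight l l l' m')%:~R)).
  apply: eq_bigr => l' _; rewrite (bigD1 l') //= big1 => [|m' ml'].
    by rewrite addr0 /branch_weight !eqxx; case: ifP.
  rewrite /branch_weight eqxx [l' == m' :> nat]eq_sym.
  by rewrite (negPf ml' : (m' == l' :> nat) = false) mulr0.
apply: eq_bigr => m ml; rewrite (bigD1 (l, m)) //= big1 => [|[l' m'] lm'] /=.
  rewrite addr0 /branch_weight [l == m :> nat]eq_sym (negPf ml : (m == l :> nat) = false) !eqxx /=.
  by do 2?case: ifP.
rewrite /branch_weight [l == m :> nat]eq_sym (negPf ml : (m == l :> nat) = false).
rewrite -pair_eqE /pair_eq /= eq_sym [m' == m]eq_sym in lm'.
rewrite (negPf lm' : (l == l' :> nat) && (m == m' :> nat) = false).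
by rewrite mulr0.
Qed.

Lemma RdagR_psi7 (R : realType) (a : 'rV[R]_4) i j :
  let b (l m : 'I_4) (k : 'I_3) : R[i] := pauli k (branch m ord_max) (branch l ord_max) in
  RdagR (psi7 a) i j
  = \sum_l \sum_l' (a 0 l ^+ 2 * a 0 l' ^+ 2)%:C%C * ((b l l i)^* * b l' l' j)
        * (if odd (l + l') then -1 else 1)
    + \sum_l \sum_(m | m != l) (a 0 l ^+ 2 * a 0 m ^+ 2)%:C%C * ((b l m i)^* * b l m j)
        * (if (l + m == 3)%N then 32 else if odd (l + m) then 8 else 16).
Proof.
move=> b; rewrite psi7E RdagR_superposition.
under eq_bigr => p _ do under eq_bigr => p' _ do rewrite branch_weightE mulrAC.
rewrite (sum_branch_weight (fun l m l' m' =>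
  (a 0 l * a 0 m * (a 0 l' * a 0 m'))%:C%C * ((b l m i)^* * b l' m' j))).
by congr (_ + _); apply: eq_bigr => l _; apply: eq_bigr => m _;
  congr (_%:C%C * _ * _); ring.
Qed.

Definition corr_xy (R : realType) (a : 'rV[R]_4) : R :=
  16 * (a 0 0 ^+ 2 + a 0 2 ^+ 2) * (a 0 1 ^+ 2 + a 0 3 ^+ 2)
  + 48 * (a 0 0 ^+ 2 * a 0 3 ^+ 2 + a 0 1 ^+ 2 * a 0 2 ^+ 2).

Definition corr_z (R : realType) (a : 'rV[R]_4) : R :=
  1 + 32 * a 0 0 ^+ 2 * a 0 2 ^+ 2 + 32 * a 0 1 ^+ 2 * a 0 3 ^+ 2.

(** The last bit of a branch is the parity of its index: pairs of equal parity see only sigma_z, the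
    others only sigma_x and sigma_y. The mixed x-y products are imaginary and cancel between (l, m)
    and (m, l). *)
Lemma RdagR_psi7_diag (R : realType) (a : 'rV[R]_4) : sphere3 a ->
  RdagR (psi7 a) = diag_mx (\row_i (if i == 2 then corr_z a else corr_xy a)%:C%C).
Proof.
rewrite /sphere3 /= sum_ord4 => a1.
have last_bit (m : 'I_4) : branch m ord_max = (if odd m then 1 else 0).
  by apply: val_inj; rewrite /= val_branch; case: m => [[|[|[|[|//]]]] ?].
(* The constant 1 is homogenized by normalization, which leaves polynomial identities for [ring]. *)
have -> : corr_z a = (a 0 0 ^+ 2 + a 0 1 ^+ 2 + a 0 2 ^+ 2 + a 0 3 ^+ 2) ^+ 2
    + 32 * a 0 0 ^+ 2 * a 0 2 ^+ 2 + 32 * a 0 1 ^+ 2 * a 0 3 ^+ 2.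
  by rewrite a1 expr1n.
rewrite /corr_xy.
have ii : 'i * 'i = -1 :> R[i] by rewrite -expr2 sqrCi.
apply/matrixP => i j; rewrite RdagR_psi7.
under [X in _ + X]eq_bigr do rewrite big_mkcond /=.
rewrite !sum_ord4 !last_bit /= !mxE.
case: i => [[|[|[|//]]] iP]; case: j => [[|[|[|//]]] jP];
  rewrite !mxE /= ?rmorphN /= ?conjCi ?rmorph0 ?rmorph1;
  ring: ii.
Qed.

(** * The bound on Bell's inequality *)

Lemma bell_bound_psi7 (R : realType) (a : 'rV[R]_4) :
  sphere3 a -> corr_z a <= corr_xy a -> bell_bound (psi7 a) = 2 * Num.sqrt (2 * corr_xy a).
Proof.
move=> /RdagR_psi7_diag aE zxy; rewrite /bell_bound aE.
set s := sort _ _.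
suff -> : s = [:: corr_xy a; corr_xy a; corr_z a].
  by rewrite /= (mulr_natl (corr_xy a) 2) mulr2n.
(* The eigenvalues are known up to permutation only; sorting by a total order removes the
   ambiguity. *)
have -> : s = sort >=%R [:: corr_xy a; corr_xy a; corr_z a].
  apply/perm_sortP.
  - by move=> x y; apply: le_total.
  - by move=> x y z /= xy yz; apply: le_trans xy.
  - by move=> x y /andP[xy yx]; apply/le_anti/andP.
  have /(perm_map (@complex.Re R)) := eigenvalues_diag (diag_mx_is_diag
    (\row_i (if i == 2 then corr_z a else corr_xy a)%:C%C : 'rV_3)).
  move/perm_trans; apply; rewrite -map_comp.
  have -> : enum 'I_3 = [:: 0; 1; 2].
    by apply: (inj_map val_inj); rewrite val_enum_ord.
  by rewrite /= !mxE /=.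
apply: sorted_sort => /=; last by rewrite lexx zxy.
by move=> x y z /= xy yz; apply: le_trans xy.
Qed.

(** * Expectations of Bell operators *)

Section BellOperator.
Context (R : realType).
Local Notation C := R[i].

Definition pauli_string n (I : {ffun 'I_n -> 'I_3}) (j : 'I_3) : 'M[C]_(qdim n.+1) :=
  tensor (fun q => pauli (if unlift ord_max q is Some q' then I q' else j)).

Lemma tensor_pauli_vec n (w : 'I_n.+1 -> 'rV[R]_3) :
  tensor (fun q => pauli_vec (w q))
  = \sum_(I : {ffun 'I_n -> 'I_3}) \sum_j
      (\prod_q w (lift ord_max q) 0 (I q) * w ord_max 0 j)%:C%C *: pauli_string I j.
Proof.
apply/matrixP => x y; rewrite -(enum_valK x) -(enum_valK y) tensor_recr.
have pauli_vecE (v : 'rV[R]_3) i j : pauli_vec v i j = \sum_k (v 0 k)%:C%C * pauli k i j.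
  by rewrite /pauli_vec summxE; apply: eq_bigr => k _; rewrite mxE.
under eq_bigr do rewrite pauli_vecE.
rewrite bigA_distr_bigA pauli_vecE mulr_suml summxE; apply: eq_bigr => I _ /=.
rewrite mulr_sumr summxE; apply: eq_bigr => j _.
rewrite mxE /pauli_string tensor_recr unlift_none big_split /= rmorphM rmorph_prod /=.
under [X in _ = _ * (X * _)]eq_bigr => q _ do rewrite liftK.
ring.
Qed.

Lemma trace_tensor_pauli_vec n (psi : 'cV[C]_(qdim n.+1)) (w : 'I_n.+1 -> 'rV[R]_3) :
  \tr (density psi *m tensor (fun q => pauli_vec (w q)))
  = \sum_(I : {ffun 'I_n -> 'I_3}) (\prod_q w (lift ord_max q) 0 (I q))%:C%C
      * \sum_j Rmatrix psi (enum_rank I) j * (w ord_max 0 j)%:C%C.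
Proof.
rewrite tensor_pauli_vec mulmx_sumr raddf_sum /=; apply: eq_bigr => I _.
rewrite mulmx_sumr raddf_sum mulr_sumr /=; apply: eq_bigr => j _.
rewrite -scalemxAr mxtraceZ mxE enum_rankK -/(pauli_string I j) rmorphM /=.
ring.
Qed.

(** The right side is the squared norm of [Rmatrix psi] applied to c; keeping only real parts of the
    entries can only decrease it. *)
Lemma sum_sqr_correlations n (psi : 'cV[C]_(qdim n.+1)) (d c : 'rV[R]_3) :
  RdagR psi = diag_mx (map_mx (real_complex R) d) ->
  \sum_(I : {ffun 'I_n -> 'I_3})
      complex.Re (\sum_j Rmatrix psi (enum_rank I) j * (c 0 j)%:C%C) ^+ 2
  <= \sum_j d 0 j * c 0 j ^+ 2.
Proof.
move=> dE; pose v : 'cV[C]_3 := \col_j (c 0 j)%:C%C.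
have : ((v ^t* *m RdagR psi *m v) 0 0 : C) = (\sum_j d 0 j * c 0 j ^+ 2)%:C%C.
  rewrite dE mul_mx_diag mxE rmorph_sum; apply: eq_bigr => j _.
  by rewrite !mxE conj_realC -!rmorphM /=; congr (_%:C%C); ring.
rewrite /RdagR mulmxA -mulmxA -map_mxM -trmx_mul mxE.
rewrite (reindex (@enum_rank {ffun 'I_n -> 'I_3})) /=; last first.
  by exists enum_val => x _; rewrite ?enum_rankK ?enum_valK.
move/(congr1 (@complex.Re R)) => /= <-; rewrite raddf_sum /=; apply: ler_sum => I _.
rewrite [X in X * _]mxE [X in X^* * _]mxE.
have -> : (Rmatrix psi *m v) (enum_rank I) 0 = \sum_j Rmatrix psi (enum_rank I) j * (c 0 j)%:C%C.
  by rewrite mxE; apply: eq_bigr => j _; rewrite [v _ _]mxE.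
case: (\sum_j _) => x y /=.
rewrite -expr2 mulNr opprK lerDl -expr2; exact: sqr_ge0.
Qed.

(* AM-GM in place of Cauchy-Schwarz; [lam] is optimised by the caller. *)
Lemma trace_tensor_le n (psi : 'cV[C]_(qdim n.+1)) (d : 'rV[R]_3)
    (w : 'I_n.+1 -> 'rV[R]_3) (lam : R) :
  RdagR psi = diag_mx (map_mx (real_complex R) d) ->
  (forall q, q != ord_max -> unit_vec (w q)) -> 0 < lam ->
  complex.Re (\tr (density psi *m tensor (fun q => pauli_vec (w q))))
  <= (lam + (\sum_j d 0 j * w ord_max 0 j ^+ 2) / lam) / 2.
Proof.
move=> /(sum_sqr_correlations (w ord_max)) dle w1 lam0.
rewrite trace_tensor_pauli_vec raddf_sum /=.
(* A tensor product of unit vectors is a unit vector. *)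
have prod1 : \sum_(I : {ffun 'I_n -> 'I_3}) (\prod_q w (lift ord_max q) 0 (I q)) ^+ 2 = 1.
  under eq_bigr do rewrite -prodrXl.
  rewrite -(bigA_distr_bigA (fun q j => w (lift ord_max q) 0 j ^+ 2)).
  by apply: big1 => q _; apply: w1; rewrite eq_sym neq_lift.
apply: (@le_trans _ _ (\sum_(I : {ffun 'I_n -> 'I_3})
   (lam * (\prod_q w (lift ord_max q) 0 (I q)) ^+ 2
    + complex.Re (\sum_j Rmatrix psi (enum_rank I) j * (w ord_max 0 j)%:C%C) ^+ 2 / lam) / 2)).
  apply: ler_sum => I _; set p := \prod_q _; case: (\sum_j _) => x y /=.
  rewrite mul0r subr0.
  have : 0 <= (lam * p - x) ^+ 2 / lam by rewrite divr_ge0 ?sqr_ge0 ?ltW.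
  have -> : (lam * p - x) ^+ 2 / lam = lam * p ^+ 2 + x ^+ 2 / lam - 2 * (p * x).
    by field; rewrite gt_eqF.
  lra.
rewrite -mulr_suml big_split /= -mulr_sumr prod1 mulr1 -mulr_suml.
by rewrite ler_pM2r ?invr_gt0 // lerD2l ler_pM2r ?invr_gt0.
Qed.

Lemma pauli_vecD (u v : 'rV[R]_3) : pauli_vec (u + v) = pauli_vec u + pauli_vec v.
Proof.
rewrite /pauli_vec -big_split; apply: eq_bigr => j _ /=.
by rewrite mxE rmorphD scalerDl.
Qed.

Lemma pauli_vecN (u : 'rV[R]_3) : pauli_vec (- u) = - pauli_vec u.
Proof.
rewrite /pauli_vec -sumrN; apply: eq_bigr => j _ /=.
by rewrite mxE rmorphN scaleNr.
Qed.

(** On the last qubit the two terms carry v + v' and v - v', whose squared lengths add up to 4 by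
    the parallelogram law. *)
Lemma bell_op_le n (psi : 'cV[C]_(qdim n.+1)) (d : 'rV[R]_3) (u : R)
    (v v' : 'I_n.+1 -> 'rV[R]_3) :
  RdagR psi = diag_mx (map_mx (real_complex R) d) -> (forall j, d 0 j <= u) -> 0 < u ->
  (forall q, unit_vec (v q)) -> (forall q, unit_vec (v' q)) ->
  complex.Re (\tr (density psi *m bell_op v v')) <= 2 * Num.sqrt (2 * u).
Proof.
move=> dE du u0 v1 v'1.
pose w q := if q == ord_max then v q + v' q else v q.
pose w' q := if q == ord_max then v q - v' q else v' q.
have -> : bell_op v v' = tensor (fun q => pauli_vec (w q)) + tensor (fun q => pauli_vec (w' q)).
  rewrite /bell_op; congr (tensor _ + tensor _); apply: funext => q; rewrite /w /w';
  by case: ifP; rewrite ?pauli_vecD ?pauli_vecN.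
rewrite mulmxDr mxtraceD raddfD /=.
(* This value minimises lam + 2 u / lam, the sum of the two bounds. *)
pose lam := Num.sqrt (2 * u).
have lam0 : 0 < lam by rewrite sqrtr_gt0 mulr_gt0.
have lam2 : lam ^+ 2 = 2 * u by rewrite sqr_sqrtr // ltW // mulr_gt0.
have le1 := trace_tensor_le dE (w := w) _ lam0.
have le2 := trace_tensor_le dE (w := w') _ lam0.
apply: le_trans (lerD (le1 _) (le2 _)) _.
- by move=> q /negPf qm; rewrite /w qm.
- by move=> q /negPf qm; rewrite /w' qm.
rewrite -mulrDl -[2 * _]mulrC ler_pdivrMr //.
have -> : lam + (\sum_j d 0 j * w ord_max 0 j ^+ 2) / lam
   + (lam + (\sum_j d 0 j * w' ord_max 0 j ^+ 2) / lam)
   = 2 * lam + (\sum_j d 0 j * (w ord_max 0 j ^+ 2 + w' ord_max 0 j ^+ 2)) / lam.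
  under [in RHS]eq_bigr do rewrite mulrDr.
  by rewrite big_split /=; ring.
have le4 : \sum_j d 0 j * (w ord_max 0 j ^+ 2 + w' ord_max 0 j ^+ 2) <= u * 4.
  have -> : 4 = \sum_j (w ord_max 0 j ^+ 2 + w' ord_max 0 j ^+ 2).
    rewrite /w /w' eqxx.
    under eq_bigr => j _.
      rewrite !mxE.
      have -> : (v ord_max 0 j + v' ord_max 0 j) ^+ 2 + (v ord_max 0 j - v' ord_max 0 j) ^+ 2
         = 2 * v ord_max 0 j ^+ 2 + 2 * v' ord_max 0 j ^+ 2 by ring.
      over.
    by rewrite big_split /= -!mulr_sumr v1 v'1; ring.
  rewrite mulr_sumr; apply: ler_sum => j _.
  by rewrite ler_wpM2r // addr_ge0 ?sqr_ge0.
have : (\sum_j d 0 j * (w ord_max 0 j ^+ 2 + w' ord_max 0 j ^+ 2)) / lam <= 2 * lam.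
  by rewrite ler_pdivrMr // -mulrA -expr2 lam2; lra.
by rewrite -/lam; lra.
Qed.

End BellOperator.

(** * Entropies, concurrences and angles *)

(* Qubits 0-2, qubit 3 and qubits 4-6 carry the patterns 0011, 0110 and 0101
   across the four branches; two different patterns separate all branches. *)
Lemma restrict_branch (S : {set 'I_7}) (l m : 'I_4) :
  (restrict S (branch l) == restrict S (branch m))
  = [&& [exists q in S, (q < 3)%N] ==> ((1 < l)%N == (1 < m)%N),
        [exists q in S, q == 3%N :> nat] ==> ((0 < l < 3)%N == (0 < m < 3)%N)
      & [exists q in S, (3 < q)%N] ==> (odd l == odd m)].
Proof.
have bitE (k : 'I_4) (q : 'I_7) : branch k q
    = (if (q < 3)%N then (1 < k)%N else if q == 3%N :> nat then (0 < k < 3)%N else odd k) :> nat.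
  by rewrite val_branch; case: k => [[|[|[|[|//]]]] ?]; case: q => [[|[|[|[|[|[|[|//]]]]]]] ?].
pose pat (q : 'I_7) := if (q < 3)%N then (1 < l)%N == (1 < m)%N else
  if q == 3%N :> nat then (0 < l < 3)%N == (0 < m < 3)%N else odd l == odd m.
have bits (q : 'I_7) : (branch l q == branch m q) = pat q.
  have nat_bool (b c : bool) : (b == c :> nat) = (b == c) by case: b; case: c.
  by rewrite -val_eqE /= !bitE /pat; case: ifP => _; [|case: ifP => _]; rewrite nat_bool.
apply/eqP/and3P => [/ffunP lm | [/implyP hX /implyP hY /implyP hZ]].
  have {}lm (q : 'I_7) : q \in S -> pat q.
    by move=> qS; rewrite -bits; apply/eqP; have := lm (exist _ q qS); rewrite !ffunE.
  split; apply/implyP => /existsP[q /andP[qS qE]]; have := lm q qS; rewrite /pat.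
  - by rewrite qE.
  - by rewrite (eqP qE).
  by rewrite ltnNge (ltnW qE) /= gtn_eqF.
apply/ffunP => -[q qS]; rewrite [LHS]ffunE [RHS]ffunE; apply/eqP; rewrite bits /pat /=.
case: ifP => q3; first by apply: hX; apply/existsP; exists q; rewrite qS.
case: ifP => q3'; first by apply: hY; apply/existsP; exists q; rewrite qS.
apply: hZ; apply/existsP; exists q; rewrite qS /=.
by rewrite ltn_neqAle eq_sym q3' leqNgt q3.
Qed.

(** On the full register, the patterns of qubits 0-2 and of qubit 3 already determine the index. *)
Lemma branch_inj : injective branch.
Proof.
move=> l m lm; apply/eqP; have := restrict_branch [set: _]%SET l m.
rewrite lm eqxx => /esym/and3P[] /implyP hX /implyP hY _.
have {}hX : (1 < l)%N == (1 < m)%N by apply: hX; apply/existsP; exists 0; rewrite inE.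
have {hY}: (0 < l < 3)%N == (0 < m < 3)%N.
  by apply: hY; apply/existsP; exists (inord 3); rewrite inE inordK.
by case: l m hX {lm} => [[|[|[|[|//]]]] ?] [[|[|[|[|//]]]] ?].
Qed.

Section Branches.
Context (R : realType).
Local Notation C := R[i].

(** Each of the three blocks of qubits meets S or its complement, so one side meets two blocks and
    separates the branches. The other side is nonempty: it meets one block, giving two classes, or
    more, giving four. *)
Lemma vN_entropy_psi7 (S : {set 'I_7}) : S != finset.set0 -> S != [set: 'I_7]%SET ->
  exists r (cls : 'I_4 -> 'I_r),
    [/\ (1 < r)%N, forall c, (#|[pred m | cls m == c]| * r)%N = 4
      & forall a : 'rV[R]_4,
          let p c := \sum_(m | cls m == c) a 0 m ^+ 2 in
          vN_entropy (reduced S (density (psi7 a))) = - \sum_c p c * ln (p c)].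
Proof.
move=> S0 ST; set entropy_law := (exists r, _).
have cover (P : pred 'I_7) (q : 'I_7) : P q ->
    [exists q in S, P q] || [exists q in ~: S, P q]%SET.
  move=> Pq; case: (boolP (q \in S)) => qS; apply/orP; [left|right];
  by apply/existsP; exists q; rewrite ?inE qS.
have cX := cover (fun q => (q < 3)%N) 0 isT.
have cY : [exists q in S, q == 3%N :> nat] || [exists q in ~: S, q == 3%N :> nat]%SET.
  by apply: (cover _ (inord 3)); rewrite inordK.
have cZ : [exists q in S, (3 < q)%N] || [exists q in ~: S, (3 < q)%N]%SET.
  by apply: (cover _ (inord 4)); rewrite inordK.
have nonempty (U : {set 'I_7}) : U != finset.set0 ->
   [|| [exists q in U, (q < 3)%N], [exists q in U, q == 3%N :> nat] | [exists q in U, (3 < q)%N]].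
  case/set0Pn => q qU; case: (ltngtP q 3%N) => q3; apply/or3P; [constructor 1|constructor 3|constructor 2];
  by apply/existsP; exists q; rewrite qU ?q3.
have nS := nonempty _ S0.
have nT : (~: S != finset.set0)%SET by rewrite -finset.setCT (inj_eq (@finset.setC_inj _)).
have {nonempty} nT := nonempty _ nT.
have main r (cls : 'I_4 -> 'I_r) : (1 < r)%N -> (forall c, (#|[pred m | cls m == c]| * r)%N = 4) ->
  (forall l m, restrict S (branch l) == restrict S (branch m) = (l == m)) /\
  (forall l m, restrict (~: S)%SET (branch l) == restrict (~: S)%SET (branch m) = (cls l == cls m))
  \/ (forall l m, restrict (~: S)%SET (branch l) == restrict (~: S)%SET (branch m) = (l == m)) /\
  (forall l m, restrict S (branch l) == restrict S (branch m) = (cls l == cls m)) ->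
  entropy_law.
  move=> r1 clsE H; exists r, cls; split=> // a; rewrite psi7E.
  case: H => -[injU clsU].
    by have [] := vN_entropy_superposition a (or_introl erefl) injU clsU.
  by have [] := vN_entropy_superposition a (or_intror erefl) injU clsU.
pose two (f : nat -> bool) (m : 'I_4) : 'I_2 := inord (f m).
have twoE f l m : (two f l == two f m) = (f l == f m).
  by rewrite /two -(inj_eq val_inj) /= !inordK ?ltnS ?leq_b1 //; case: (f l); case: (f m).
have two_card (f : nat -> bool) : (f 0 + f 1 + f 2 + f 3)%N = 2 ->
    forall c, (#|[pred m | two f m == c]| * 2)%N = 4.
  move=> f2 c; rewrite -sum1_card big_mkcond sum_ord4 /= !inE -!(inj_eq val_inj) /=.
  rewrite !inordK ?ltnS ?leq_b1 //.
  by move: f2; case: c => [[|[|//]] ?]; case: (f 0); case: (f 1); case: (f 2); case: (f 3).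
have inj2 (x y z : bool) : (1 < x + y + z)%N -> forall l m : 'I_4,
   [&& x ==> ((1 < l)%N == (1 < m)%N), y ==> ((0 < l < 3)%N == (0 < m < 3)%N)
     & z ==> (odd l == odd m)] = (l == m).
  move=> xyz [l lP] [m mP]; move: l lP m mP xyz.
  by do 2![case=> [|[|[|[|//]]]] ?]; case: x; case: y; case: z.
have id_card (c : 'I_4) : (#|[pred m | m == c]| * 4)%N = 4 by rewrite card1.
have mainX := main 2 _ isT (two_card (fun m => (1 < m)%N) erefl).
have mainY := main 2 _ isT (two_card (fun m => (0 < m < 3)%N) erefl).
have mainZ := main 2 _ isT (two_card odd erefl).
have mainI := main 4 id isT id_card.
have rS := restrict_branch S; have rT := restrict_branch (~: S)%SET.
(* The case analysis is on which blocks meet which side; in the alternatives below, [left] takes S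
   as the separating side and [right] its complement. *)
move: cX cY cZ nS nT rS rT {main cover two_card id_card}.
case: [exists q in S, (q < 3)%N]; case: [exists q in (~: S)%SET, (q < 3)%N] => // _;
case: [exists q in S, q == 3%N :> nat]; case: [exists q in (~: S)%SET, q == 3%N :> nat] => // _;
case: [exists q in S, (3 < q)%N]; case: [exists q in (~: S)%SET, (3 < q)%N] => // _ _ _ rS rT;
first [ by apply: mainI; left; split=> l m; rewrite ?rS ?rT inj2
      | by apply: mainX; left; split=> l m; [rewrite ?rS ?rT inj2 | rewrite ?rS ?rT twoE /= ?andbT]
      | by apply: mainY; left; split=> l m; [rewrite ?rS ?rT inj2 | rewrite ?rS ?rT twoE /= ?andbT]
      | by apply: mainZ; left; split=> l m; [rewrite ?rS ?rT inj2 | rewrite ?rS ?rT twoE /= ?andbT]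
      | by apply: mainX; right; split=> l m; [rewrite ?rS ?rT inj2 | rewrite ?rS ?rT twoE /= ?andbT]
      | by apply: mainY; right; split=> l m; [rewrite ?rS ?rT inj2 | rewrite ?rS ?rT twoE /= ?andbT]
      | by apply: mainZ; right; split=> l m; [rewrite ?rS ?rT inj2 | rewrite ?rS ?rT twoE /= ?andbT] ].
Qed.

End Branches.

Section Branches.
Context (R : realType).
Local Notation C := R[i].

Lemma sphere3_uniform (a : 'rV[R]_4) : (forall i, a 0 i ^+ 2 = 1 / 4) -> sphere3 a.
Proof. by move=> aE; rewrite /sphere3 /= sum_ord4 !aE; lra. Qed.

(** The r classes have equal size, hence probability 1/r each. The lower bound ln 2 is meant for
    single qubits, where it meets the absolute upper bound. *)
Lemma max_entropy_psi7_family (a : 'rV[R]_4) (S : {set 'I_7}) :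
  (forall i, a 0 i ^+ 2 = 1 / 4) -> S != finset.set0 -> S != [set: 'I_7]%SET ->
  max_entropy_in [set psi7 b | b in sphere3] S (psi7 a)
  /\ ln 2 <= vN_entropy (reduced S (density (psi7 a))).
Proof.
move=> aE S0 ST; have [r [cls [r1 clsE SE]]] := vN_entropy_psi7 R S0 ST.
have r0 : (0 < r)%N by apply: ltnW.
have aS : vN_entropy (reduced S (density (psi7 a))) = ln r%:R.
  rewrite SE; apply: (entropy_uniform (card_ord r) r0) => c.
  rewrite (eq_bigr (fun=> 1 / 4)) // sumr_const -[LHS]mulr_natl.
  have /(congr1 (fun k => k%:R : R)) := clsE c; rewrite natrM => cE.
  have r0R : (r%:R : R) != 0 by rewrite pnatr_eq0 -lt0n.
  by apply: (mulIf r0R); rewrite mulVf // mulrAC cE; lra.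
split; last first.
  by rewrite aS ler_ln ?posrE ?ltr0n // ler_nat.
split; first by exists a => //; exact: sphere3_uniform.
move=> _ [b b1 <-]; rewrite [leLHS]SE aS.
apply: (entropy_sum_le (card_ord r) r0).
  by left=> c; apply: sumr_ge0 => m _; apply: sqr_ge0.
by move: b1; rewrite /sphere3 /= (partition_big cls predT).
Qed.

Lemma max_entropy_psi7_qubit (a : 'rV[R]_4) (q : 'I_7) :
  (forall i, a 0 i ^+ 2 = 1 / 4) -> max_entropy_in (@normalized R _) [set q]%SET (psi7 a).
Proof.
move=> aE; split.
  by rewrite psi7E; apply: normalized_superposition branch_inj (sphere3_uniform aE).
move=> phi /vN_entropy_reduced1_le /le_trans; apply.
have q0 : [set q]%SET != finset.set0 by apply/set0Pn; exists q; rewrite inE.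
have qT : [set q]%SET != [set: 'I_7]%SET.
  by apply/eqP => /(congr1 (fun S : {set 'I_7} => #|S|)); rewrite cards1 cardsT card_ord.
by have [] := max_entropy_psi7_family aE q0 qT.
Qed.

Lemma concurrenceA_psi7 (a : 'rV[R]_4) : sphere3 a ->
  concurrenceA (psi7 a) ^+ 2
  = 4 * (a 0 0 ^+ 2 + a 0 2 ^+ 2) * (a 0 1 ^+ 2 + a 0 3 ^+ 2).
Proof.
rewrite /sphere3 /= sum_ord4 => a1; rewrite /concurrenceA psi7E trace_sqr_reduced /=; last first.
  move=> l m; rewrite restrict_branch.
  have -> : [exists q in ~: [set ord_max : 'I_7]%SET, (q < 3)%N]%SET.
    by apply/existsP; exists 0; rewrite !inE.
  have -> : [exists q in ~: [set ord_max : 'I_7]%SET, q == 3%N :> nat]%SET.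
    by apply/existsP; exists (inord 3); rewrite !inE -val_eqE /= inordK.
  have -> : [exists q in ~: [set ord_max : 'I_7]%SET, (3 < q)%N]%SET.
    by apply/existsP; exists (inord 4); rewrite !inE -val_eqE /= inordK.
  by case: l m => [[|[|[|[|//]]]] ?] [[|[|[|[|//]]]] ?].
have rE (l m : 'I_4) : (restrict [set ord_max]%SET (branch l) == restrict [set ord_max]%SET (branch m))
    = (odd l == odd m).
  rewrite restrict_branch.
  have /negPf -> : ~~ [exists q in [set ord_max : 'I_7]%SET, (q < 3)%N].
    by apply/existsPn => q; rewrite inE; case: eqP => // ->.
  have /negPf -> : ~~ [exists q in [set ord_max : 'I_7]%SET, q == 3%N :> nat].
    by apply/existsPn => q; rewrite inE; case: eqP => // ->.
  have -> // : [exists q in [set ord_max : 'I_7]%SET, (3 < q)%N].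
  by apply/existsP; exists ord_max; rewrite inE eqxx.
rewrite !sum_ord4 !rE /=.
set s := a 0 0 ^+ 2 in a1 *; set t := a 0 1 ^+ 2 in a1 *.
set u := a 0 2 ^+ 2 in a1 *; set v := a 0 3 ^+ 2 in a1 *.
(* The radicand equals the claimed nonnegative product, since 1 - x^2 - y^2 = 2 x y when x + y =
   1. *)
rewrite sqr_sqrtr; last first.
  have st : s + t + u + v = 1 by [].
  have : 0 <= 4 * (s + u) * (t + v) by rewrite !mulr_ge0 ?addr_ge0 ?sqr_ge0.
  have -> : t + v = 1 - (s + u) by lra.
  have -> : v = 1 - s - t - u by lra.
  nra.
have -> : v = 1 - s - t - u by lra.
ring.
Qed.

(** * Spherical angles *)

Lemma sphere3_angle (t1 t2 t3 : R) : sphere3 (angle_coef t1 t2 t3).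
Proof.
rewrite /sphere3 /= sum_ord4 !mxE /=.
have := cos2Dsin2 t1; have := cos2Dsin2 t2; have := cos2Dsin2 t3 => e3 e2 e1.
transitivity (sin t1 ^+ 2 + cos t1 ^+ 2 * (sin t2 ^+ 2 + cos t2 ^+ 2 * (cos t3 ^+ 2 + sin t3 ^+ 2))).
  by ring.
by rewrite e3 mulr1 [sin t2 ^+ 2 + _]addrC e2 mulr1 addrC.
Qed.

Lemma exists_angle (x y : R) : x ^+ 2 + y ^+ 2 = 1 -> exists t, cos t = x /\ sin t = y.
Proof.
move=> xy.
have x2 : x ^+ 2 <= 1 by have := sqr_ge0 y; lra.
have x1 : -1 <= x <= 1 by rewrite -ler_norml -sqrtr_sqr -[leRHS]sqrtr1 ler_sqrt.
have sE : sin (acos x) = `|y|.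
  by rewrite sin_acos // -sqrtr_sqr; congr Num.sqrt; lra.
have [y0|y0] := leP 0 y.
  by exists (acos x); rewrite acosK ?in_itv //= sE ger0_norm.
by exists (- acos x); rewrite cosN sinN acosK ?in_itv //= sE ltr0_norm // opprK.
Qed.

Lemma exists_angle_coef (a : 'rV[R]_4) : (forall i, a 0 i ^+ 2 = 1 / 4) ->
  exists t1 t2 t3, a = angle_coef t1 t2 t3.
Proof.
move=> aE.
(* [r1] and [r2] are the norms of the last three and last two coefficients, taken as cos t1 and cos
   t1 cos t2; the remaining sines and cosines carry the signs. *)
pose r2 := Num.sqrt (1 / 2 : R); pose r1 := Num.sqrt (3 / 4 : R).
have r2E : r2 ^+ 2 = 1 / 2 by rewrite sqr_sqrtr; lra.
have r1E : r1 ^+ 2 = 3 / 4 by rewrite sqr_sqrtr; lra.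
have r20 : r2 != 0 by rewrite gt_eqF // sqrtr_gt0; lra.
have r10 : r1 != 0 by rewrite gt_eqF // sqrtr_gt0; lra.
have [|t1 [c1 s1]] := @exists_angle r1 (a 0 0); first by rewrite r1E aE; lra.
have [|t2 [c2 s2]] := @exists_angle (r2 / r1) (a 0 1 / r1).
  by rewrite !expr_div_n aE r1E r2E; lra.
have [|t3 [c3 s3]] := @exists_angle (a 0 2 / r2) (a 0 3 / r2).
  by rewrite !expr_div_n !aE r2E; lra.
exists t1, t2, t3; apply/rowP => i; rewrite mxE c1 s1 c2 s2 c3 s3.
case: i => [[|[|[|[|//]]]] iP] /=.
- by congr (a 0 _); apply: val_inj.
- by rewrite mulrCA mulfV // mulr1; congr (a 0 _); apply: val_inj.
- rewrite [r1 * _]mulrCA mulfV // mulr1 mulrCA mulfV // mulr1.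
  by congr (a 0 _); apply: val_inj.
rewrite [r1 * _]mulrCA mulfV // mulr1 mulrCA mulfV // mulr1.
by congr (a 0 _); apply: val_inj.
Qed.

Lemma concurrences_psi7_uniform (a : 'rV[R]_4) t1 t2 t3 :
  (forall i, a 0 i ^+ 2 = 1 / 4) -> a = angle_coef t1 t2 t3 ->
  C1A t1 ^+ 2 = 3 / 4 /\ C2A t1 t2 ^+ 2 = 3 / 4.
Proof.
move=> aE aA.
have s1 : sin t1 ^+ 2 = 1 / 4 by rewrite -(aE 0) aA mxE.
have c1 : cos t1 ^+ 2 = 3 / 4 by have := cos2Dsin2 t1; lra.
have s2 : cos t1 ^+ 2 * sin t2 ^+ 2 = 1 / 4 by rewrite -exprMn -(aE 1) aA mxE.
have c2 : cos t1 ^+ 2 * cos t2 ^+ 2 = 1 / 2.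
  have := cos2Dsin2 t2; move/(congr1 (fun x => cos t1 ^+ 2 * x)).
  by rewrite mulrDr s2 c1; lra.
split; apply: etrans (concurrenceA_psi7 (sphere3_angle _ _ _)) _;
  rewrite !mxE /= ?sin_pihalf ?cos_pihalf cos0 sin0 !(mulr0, mulr1, mul0r, expr0n, addr0) /= ?addr0.
  by rewrite s1 c1; lra.
by rewrite !exprMn s1 s2 c2; lra.
Qed.

End Branches.

(** * The critical point *)

Section CriticalPoint.
Context (R : realType).
Context (a : 'rV[R]_4) (aE : forall i, a 0 i ^+ 2 = 1 / 4).

Lemma corr_xy_uniform : corr_xy a = 10.
Proof. by rewrite /corr_xy !aE; lra. Qed.

Lemma corr_z_uniform : corr_z a = 5.
Proof. by rewrite /corr_z !aE; lra. Qed.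

Lemma bell_bound_uniform : bell_bound (psi7 a) = 2 * Num.sqrt (2 * 10).
Proof.
rewrite bell_bound_psi7 ?corr_xy_uniform ?corr_z_uniform //; first exact: sphere3_uniform.
by rewrite ler_nat.
Qed.

(** Along a curve only the squared coefficients [P i] matter, and their derivatives sum to 0 by
    normalization. *)
Lemma critical_psi7 : critical_on sphere3 (fun b : 'rV[R]_4 => bell_bound (psi7 b)) a.
Proof.
split; first exact: sphere3_uniform.
move=> c c_sphere c0 /derivable_mxP c_der.
pose P i : R -> R := (fun t => c t 0 i) ^+ 2.
have PtE i t : P i t = c t 0 i ^+ 2 by [].
pose E i : R := 'D_1 (P i) 0.
have PE i : is_derive (0 : R) 1 (P i) (E i).
  by apply: DeriveDef => //; apply: derivableX; exact: c_der.
have P0 i : P i 0 = 1 / 4 by rewrite -(aE i) -c0.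
have sumE : E 0 + E 1 + E 2 + E 3 = 0.
  have := is_deriveD (is_deriveD (is_deriveD (PE 0) (PE 1)) (PE 2)) (PE 3).
  have P1 : \forall t \near (0 : R), (P 0 + P 1 + P 2 + P 3) t = cst 1 t.
    by apply: filterS c_sphere => t; rewrite /sphere3 /= sum_ord4 -!PtE.
  by move/(near_eq_is_derive P1) => /@derive_val <-; rewrite derive_cst.
pose H := 16 *: ((P 0 + P 2) * (P 1 + P 3)) + 48 *: (P 0 * P 3 + P 1 * P 2).
have HE t : H t = corr_xy (c t) by rewrite /corr_xy -mulrA.
have H0 : is_derive (0 : R) 1 H 0.
  have HD := is_deriveD
    (is_deriveZ 16 (is_deriveM (is_deriveD (PE 0) (PE 2)) (is_deriveD (PE 1) (PE 3))))
    (is_deriveZ 48 (is_deriveD (is_deriveM (PE 0) (PE 3)) (is_deriveM (PE 1) (PE 2)))).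
  apply: is_derive_eq HD _.
  transitivity (16 * ((P 0 0 + P 2 0) * (E 1 + E 3) + (P 1 0 + P 3 0) * (E 0 + E 2))
     + 48 * (P 0 0 * E 3 + P 3 0 * E 0 + (P 1 0 * E 2 + P 2 0 * E 1))); first by [].
  (* Every [E i] now has the coefficient 16/2 + 48/4 = 20, so [sumE] concludes. *)
  by rewrite !P0; lra.
pose G := 32 *: (P 0 * P 2) + 32 *: (P 1 * P 3).
have GE t : corr_z (c t) = 1 + G t.
  transitivity (1 + (32 * (P 0 t * P 2 t) + 32 * (P 1 t * P 3 t))); last by [].
  by rewrite /corr_z -!PtE; ring.
(* The strict inequality 5 < 10 at t = 0 persists nearby by continuity, so the closed form of the
   bound holds along the curve near 0. *)
have zxy : \forall t \near (0 : R), corr_z (c t) < corr_xy (c t).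
  have dP i : derivable (P i) 0 1 := @ex_derive _ _ _ _ _ _ _ (PE i).
  have dG : derivable G 0 1 by apply: derivableD; apply: derivableZ; apply: derivableM.
  have dHG : derivable (H - G) 0 1 by apply: derivableB dG; by case: H0.
  have cHG : {for 0, continuous (H - G)}.
    exact/differentiable_continuous/derivable1_diffP.
  have HG0 : 1 < (H - G) 0.
    have -> : (H - G) 0 = H 0 - G 0 by [].
    have := GE 0; rewrite HE c0 corr_xy_uniform corr_z_uniform; lra.
  have near1 : \forall t \near (0 : R), 1 < (H - G) t := cvgr_gt _ cHG _ HG0.
  near=> t; have : 1 < H t - G t by near: t; exact: near1.
  by rewrite GE -HE; lra.
have d20 : is_derive (0 : R) 1 (2 *: (@Num.sqrt R \o (2 *: H))) 0.
  have h0 : 0 < (2 *: H) 0.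
    have -> : (2 *: H) 0 = 2 * H 0 by [].
    by rewrite HE c0 corr_xy_uniform; lra.
  have HD := is_deriveZ 2 (is_derive1_comp (is_derive1_sqrt h0) (is_deriveZ 2 H0)).
  by apply: is_derive_eq HD _; rewrite !scaler0 mulr0 scaler0.
apply: near_eq_is_derive d20; near=> t.
rewrite /= bell_bound_psi7; last 2 first.
- by near: t; exact: c_sphere.
- by apply: ltW; near: t; exact: zxy.
by rewrite -HE.
Unshelve. all: by end_near.
Qed.

(** The square root makes the squared coefficients affine in t, and the signs of [a] are kept. *)
Definition tilt (e : 'I_4 -> R) (t : R) : 'rV[R]_4 :=
  \row_i (a 0 i * Num.sqrt (1 + e i * t)).

Lemma tilt_sqr (e : 'I_4 -> R) (t : R) i : `|e i| = 1 -> 0 < t < 1 ->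
  tilt e t 0 i ^+ 2 = (1 + e i * t) / 4.
Proof.
move=> e1 /andP[t0 t1]; rewrite mxE exprMn aE sqr_sqrtr; first by lra.
have : `|e i * t| < 1 by rewrite normrM e1 mul1r gtr0_norm.
by rewrite ltr_norml => /andP[]; lra.
Qed.

Lemma near_tilt (Q : 'rV[R]_4 -> Prop) (e : 'I_4 -> R) : (forall i, `|e i| = 1) ->
  (\forall b \near a, Q b) -> exists t, 0 < t < 1 /\ Q (tilt e t).
Proof.
move=> e1 /nbhs_ballP[r /= r0 rQ].
pose t := Num.min (r / 2) (1 / 2).
have t01 : 0 < t < 1.
  by rewrite lt_min gt_min; apply/andP; split; [apply/andP; split|apply/orP; right]; lra.
have tr : t < r by rewrite gt_min; apply/orP; left; lra.
exists t; split=> //; apply: rQ; split=> // i j; rewrite ord1 /ball /= !mxE.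
have /andP[t0 t1] := t01.
have et : `|e j * t| = t by rewrite normrM e1 mul1r gtr0_norm.
have et0 : 0 <= 1 + e j * t.
  by have := ler_norm (- (e j * t)); rewrite normrN et; lra.
set s := Num.sqrt _; have s0 : 0 <= s := sqrtr_ge0 _.
have s2 : s ^+ 2 = 1 + e j * t by rewrite sqr_sqrtr.
have aj : `|a 0 j| <= 1.
  rewrite -sqrtr_sqr aE -[leRHS]sqrtr1 ler_sqrt //; lra.
rewrite -{1}[a 0 j]mulr1 -mulrBr normrM.
apply: le_lt_trans tr; apply: le_trans (ler_piMl (normr_ge0 _) aj) _.
(* Since s^2 = 1 + e j t, this product is |1 - s^2|; as 1 + s >= 1, it dominates |1 - s|. *)
have <- : `|1 - s| * (1 + s) = t.
  rewrite -[1 + s]ger0_norm ?addr_ge0 // -normrM -et -normrN.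
  by congr (`| _ |); rewrite -(addKr 1 (e j * t)) -s2; ring.
by rewrite ler_peMr // lerDl.
Qed.

Lemma sphere3_tilt (e : 'I_4 -> R) (t : R) : (forall i, `|e i| = 1) -> 0 < t < 1 ->
  e 0 + e 1 + e 2 + e 3 = 0 -> sphere3 (tilt e t).
Proof.
move=> e1 t01 e0; rewrite /sphere3 /= sum_ord4 !tilt_sqr //.
by rewrite -[RHS](addr0 1) -(mul0r (t / 4)) -e0; field.
Qed.

(** Both sign patterns fix (p0 + p2)(p1 + p3), where p is the vector of squared coefficients; this
    one raises p0 p3 + p1 p2 and [sgn_down] lowers it. *)
Definition sgn_up (i : 'I_4) : R := if (i == 0) || (i == 3) then 1 else -1.
Definition sgn_down (i : 'I_4) : R := if (i == 0) || (i == 1) then 1 else -1.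

Lemma norm_sgn_up i : `|sgn_up i| = 1.
Proof. by rewrite /sgn_up; case: ifP; rewrite ?normrN normr1. Qed.

Lemma norm_sgn_down i : `|sgn_down i| = 1.
Proof. by rewrite /sgn_down; case: ifP; rewrite ?normrN normr1. Qed.

Lemma sphere3_tilt_up t : 0 < t < 1 -> sphere3 (tilt sgn_up t).
Proof. by move=> t01; apply: sphere3_tilt norm_sgn_up t01 _; rewrite /sgn_up /=; ring. Qed.

Lemma sphere3_tilt_down t : 0 < t < 1 -> sphere3 (tilt sgn_down t).
Proof. by move=> t01; apply: sphere3_tilt norm_sgn_down t01 _; rewrite /sgn_down /=; ring. Qed.

Lemma bell_bound_tilt_up t : 0 < t < 1 ->
  bell_bound (psi7 (tilt sgn_up t)) = 2 * Num.sqrt (2 * (10 + 6 * t ^+ 2)).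
Proof.
move=> t01; have t2 : 0 <= t ^+ 2 := sqr_ge0 _.
have xyE : corr_xy (tilt sgn_up t) = 10 + 6 * t ^+ 2.
  by rewrite /corr_xy !(tilt_sqr (norm_sgn_up _) t01) /sgn_up /=; field.
have zE : corr_z (tilt sgn_up t) = 5 - 4 * t ^+ 2.
  by rewrite /corr_z !(tilt_sqr (norm_sgn_up _) t01) /sgn_up /=; field.
rewrite (bell_bound_psi7 (sphere3_tilt_up t01)) xyE // zE; lra.
Qed.

Lemma bell_bound_tilt_down t : 0 < t < 1 ->
  bell_bound (psi7 (tilt sgn_down t)) = 2 * Num.sqrt (2 * (10 - 6 * t ^+ 2)).
Proof.
move=> t01; have t2 : t ^+ 2 <= 1.
  by case/andP: t01 => t0 t1; rewrite expr_le1 // ltW.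
have xyE : corr_xy (tilt sgn_down t) = 10 - 6 * t ^+ 2.
  by rewrite /corr_xy !(tilt_sqr (norm_sgn_down _) t01) /sgn_down /=; field.
have zE : corr_z (tilt sgn_down t) = 5 - 4 * t ^+ 2.
  by rewrite /corr_z !(tilt_sqr (norm_sgn_down _) t01) /sgn_down /=; field.
rewrite (bell_bound_psi7 (sphere3_tilt_down t01)) xyE // zE; lra.
Qed.

Lemma saddle_psi7 : saddle_on sphere3 (fun b : 'rV[R]_4 => bell_bound (psi7 b)) a.
Proof.
split; first exact: critical_psi7.
- move=> [_ /(near_tilt norm_sgn_up) [t [t01 /(_ (sphere3_tilt_up t01))]]].
  have /andP[/(exprn_gt0 2) t2 _] := t01.
  rewrite bell_bound_tilt_up // bell_bound_uniform ler_pM2l // ler_sqrt; lra.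
move=> [_ /(near_tilt norm_sgn_down) [t [t01 /(_ (sphere3_tilt_down t01))]]].
have /andP[t0 t1] := t01.
have t2 : t ^+ 2 < 1 by rewrite expr_lt1 // ltW.
have t3 : 0 < t ^+ 2 by rewrite exprn_gt0.
rewrite bell_bound_tilt_down // bell_bound_uniform ler_pM2l // ler_sqrt; lra.
Qed.

End CriticalPoint.

Theorem mainTheorem1 (R : realType) :
  (forall a : 'rV[R]_4, sphere3 a ->
     let M := RdagR (psi7 a) in
     let dxy := 16 * (a 0 0 ^+ 2 + a 0 2 ^+ 2) * (a 0 1 ^+ 2 + a 0 3 ^+ 2)
                + 48 * (a 0 0 ^+ 2 * a 0 3 ^+ 2 + a 0 1 ^+ 2 * a 0 2 ^+ 2) in
     let dz := 1 + 32 * a 0 0 ^+ 2 * a 0 2 ^+ 2 + 32 * a 0 1 ^+ 2 * a 0 3 ^+ 2 in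
     [/\ forall i j, i != j -> M i j = 0,
         M 0 0 = (dxy%:C)%C, M 1 1 = (dxy%:C)%C & M 2 2 = (dz%:C)%C])
  /\
  (forall a : 'rV[R]_4, (forall i, a 0 i ^+ 2 = 1 / 4) ->
     let f := fun b : 'rV[R]_4 => bell_bound (psi7 b) in
     critical_on sphere3 f a
     /\ (exists t1 t2 t3, a = angle_coef t1 t2 t3)
     /\ (forall t1 t2 t3, a = angle_coef t1 t2 t3 ->
           C1A t1 ^+ 2 = 3 / 4 /\ C2A t1 t2 ^+ 2 = 3 / 4)
     /\ concurrenceA (psi7 a) ^+ 2 = 1
     (* maximally entangled: absolute maximum of the entropy for the bipartitions
        of one qubit against six (among them A | B), and maximum over the family
        for every bipartition *)
     /\ (forall q : 'I_7, max_entropy_in (@normalized R _) [set q]%SET (psi7 a))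
     /\ (forall S : {set 'I_7}, S != finset.set0 -> S != [set: 'I_7]%SET ->
           max_entropy_in [set psi7 b | b in sphere3] S (psi7 a))
     /\ f a = 4 * Num.sqrt 5
     /\ (forall v v' : 'I_7 -> 'rV[R]_3,
           (forall q, unit_vec (v q)) -> (forall q, unit_vec (v' q)) ->
           complex.Re (\tr (density (psi7 a) *m bell_op v v')) <= f a)
     /\ saddle_on sphere3 f a
     /\ ~ local_max_on sphere3 f a).
Proof.
split=> [a a1 M dxy dz | a aE f].
  have ME : M = diag_mx (\row_i (if i == 2 then dz else dxy)%:C%C) := RdagR_psi7_diag a1.
  rewrite ME; split; rewrite ?mxE //=.
  by move=> i j ij; rewrite mxE (negPf ij).
have a1 := sphere3_uniform aE.
have sad : saddle_on sphere3 f a := saddle_psi7 aE.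
have f20 : f a = 2 * Num.sqrt (2 * 10) := bell_bound_uniform aE.
split; first by case: sad.
split; first exact: exists_angle_coef.
split; first by move=> t1 t2 t3; exact: concurrences_psi7_uniform.
split; first by rewrite concurrenceA_psi7 // !aE; lra.
split; first by move=> q; exact: max_entropy_psi7_qubit.
split; first by move=> S S0 ST; have [] := max_entropy_psi7_family aE S0 ST.
split.
  rewrite f20; have -> : 2 * 10 = 2 ^+ 2 * 5 :> R by ring.
  by rewrite sqrtrM ?sqr_ge0 // sqrtr_sqr ger0_norm //; ring.
split; last by split=> //; case: sad.
move=> v v' v1 v'1; rewrite f20.
have ME : RdagR (psi7 a) = diag_mx (map_mx (real_complex R)
    (\row_i (if i == 2 then corr_z a else corr_xy a))).
  by rewrite (RdagR_psi7_diag a1); congr diag_mx; apply/rowP => i; rewrite !mxE.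
(* The diagonal entries are 10, 10 and 5, so u = 10. *)
apply: (bell_op_le ME) => // j; rewrite mxE corr_z_uniform // corr_xy_uniform //.
by case: ifP; rewrite // ler_nat.
Qed.
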